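(* Let $\Sigma: A(y) \succeq 0$ be a weakly infeasible linear matrix inequality in block-diagonal form with blocks $B_1, \dots, B_k$. For each index set $I \subseteq [k]$ such that the block subsystem of $A(y)$ with respect to $I$ is an irreducible infeasible subsystem (IIS), there exists an extremal (extreme) point $X$ of the alternative spectrahedron $S(\Sigma)$ with block support $\mathrm{BS}(X) = I$.
   Context: Let $\mathcal{S}^n$ be the set of real symmetric $n \times n$ matrices, $[n] = \{1,\dots,n\}$, let $\succeq 0$ mean positive semidefinite, and let $A \bullet B = \mathrm{tr}(A^\top B)$. For $A \in \mathcal{S}^n$ and $J \subseteq [n]$, $A_J$ is the submatrix with rows and columns indexed by $J$. Let $\mathbb{I}$ denote the identity matrix of appropriate size. Let $A_0, \dots, A_m \in \mathcal{S}^n$ and, for $y \in \mathbb{R}^m$, let $A(y) = A_0 - \sum_{i=1}^m y_i A_i$. A system $A(y) \succeq 0$ is weakly feasible if for every $\varepsilon > 0$ there is $y \in \mathbb{R}^m$ with $A(y) + \varepsilon \mathbb{I} \succeq 0$; it is weakly infeasible if it is not weakly feasible. The same terminology is used for the systems $A(y)_J \succeq 0$, $J \subseteq [n]$. Let $k \geq 1$ and let $B_1, \dots, B_k$ be nonempty sets forming a partition of $[n]$. A matrix $M \in \mathcal{S}^n$ is in block-diagonal form (with respect to these blocks) if $M_{st} = 0$ for all $(s,t) \notin (B_1 \times B_1) \cup \dots \cup (B_k \times B_k)$. The pencil $A(y)$ is in block-diagonal form if all of $A_0, A_1, \dots, A_m$ are. Standing assumption: for each $i \in [k]$, the system $A(y)_{B_i}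 \succeq 0$ is weakly feasible. For $I \subseteq [k]$ let $B(I) = \bigcup_{i \in I} B_i$; the block subsystem with respect to $I$ is $A(y)_{B(I)} \succeq 0$, and by convention the subsystem for $I = \emptyset$ is feasible. The block subsystem with respect to $I$ is an irreducible infeasible subsystem (IIS) if $A(y)_{B(I)} \succeq 0$ is weakly infeasible but $A(y)_{B(I')} \succeq 0$ is weakly feasible for all $I' \subsetneq I$. The block support of $X \in \mathcal{S}^n$ is $\mathrm{BS}(X) = \{ i \in [k] : X_{B_i} \neq 0\}$. The alternative spectrahedron of $\Sigma: A(y) \succeq 0$ is $$S(\Sigma) = \{ X \succeq 0 : A_i \bullet X = 0 \text{ for } i \in [m],\ A_0 \bullet X = -1 \},$$ where, by standing convention, only matrices $X \in \mathcal{S}^n$ in block-diagonal form with respect to $B_1,\dots,B_k$ are considered. *)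

(* Defs.v *)
From mathcomp Require Import all_boot all_order all_algebra.
From mathcomp Require Import classical_sets reals.
Set Implicit Arguments.
Unset Strict Implicit.
Unset Printing Implicit Defensive.
Import Order.TTheory GRing.Theory Num.Theory.
Local Open Scope ring_scope.

(* A_J; rows and columns are listed in increasing order of the indices. *)
Definition prin_submx (R : realType) (n : nat) (J : {set 'I_n})
    (A : 'M[R]_n) : 'M[R]_#|J| :=
  mxsub (@enum_val _ (mem J)) (@enum_val _ (mem J)) A.

(* Symmetry is part of the notion; the 0 x 0 matrix is psd. *)
Definition psd (R : realType) (n : nat) (A : 'M[R]_n) : Prop :=
  A \is symmetricmx /\ forall x : 'cV[R]_n, 0 <= (x^T *m A *m x) 0 0.

Definition mxdot (R : realType) (n : nat) (A B : 'M[R]_n) : R :=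
  \tr (A^T *m B).

Definition pencil (R : realType) (n m : nat) (A0 : 'M[R]_n)
    (A : 'I_m -> 'M[R]_n) (y : 'rV[R]_m) : 'M[R]_n :=
  A0 - \sum_(i < m) y 0 i *: A i.

Definition weakly_feasible (R : realType) (n m : nat)
    (P : 'rV[R]_m -> 'M[R]_n) : Prop :=
  forall eps : R, 0 < eps -> exists y : 'rV[R]_m, psd (P y + eps%:M).

Definition weakly_infeasible (R : realType) (n m : nat)
    (P : 'rV[R]_m -> 'M[R]_n) : Prop :=
  ~ weakly_feasible P.

(* Injectivity makes B_1, ..., B_k pairwise distinct, hence disjoint;
   partition makes them nonempty. *)
Definition block_partition (n k : nat) (B : 'I_k -> {set 'I_n}) : Prop :=
  injective B /\ (finset.partition [set B i | i : 'I_k] [set: 'I_n])%SET.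

Definition block_diagonal (R : realType) (n k : nat)
    (B : 'I_k -> {set 'I_n}) (M : 'M[R]_n) : Prop :=
  forall s t : 'I_n,
    ~ (exists i : 'I_k, s \in B i /\ t \in B i) -> M s t = 0.

Definition block_union (n k : nat) (B : 'I_k -> {set 'I_n})
    (I : {set 'I_k}) : {set 'I_n} :=
  (\bigcup_(i in I) B i)%SET.

(* For I = set0 this is a pencil of 0 x 0 matrices, so the subsystem is
   feasible, in accordance with the usual convention. *)
Definition block_subsystem (R : realType) (n m k : nat)
    (B : 'I_k -> {set 'I_n}) (A0 : 'M[R]_n) (A : 'I_m -> 'M[R]_n)
    (I : {set 'I_k}) (y : 'rV[R]_m) : 'M[R]_#|block_union B I| :=
  prin_submx (block_union B I) (pencil A0 A y).

Definition is_IIS (R : realType) (n m k : nat)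
    (B : 'I_k -> {set 'I_n}) (A0 : 'M[R]_n) (A : 'I_m -> 'M[R]_n)
    (I : {set 'I_k}) : Prop :=
  weakly_infeasible (block_subsystem B A0 A I) /\
  forall I' : {set 'I_k}, I' \proper I ->
    weakly_feasible (block_subsystem B A0 A I').

Definition block_support (R : realType) (n k : nat)
    (B : 'I_k -> {set 'I_n}) (X : 'M[R]_n) : {set 'I_k} :=
  [set i : 'I_k | prin_submx (B i) X != 0%R]%SET.

Definition alt_spectrahedron (R : realType) (n m k : nat)
    (B : 'I_k -> {set 'I_n}) (A0 : 'M[R]_n) (A : 'I_m -> 'M[R]_n) :
    set 'M[R]_n :=
  [set X : 'M[R]_n | [/\ block_diagonal B X, psd X,
      forall i : 'I_m, mxdot (A i) X = 0 & mxdot A0 X = -1]]%classic.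

Definition extreme_point (R : realType) (V : lmodType R) (S : set V) (x : V) :
    Prop :=
  S x /\
  forall (u v : V) (t : R), S u -> S v -> 0 < t < 1 ->
    x = t *: u + (1 - t) *: v -> u = x /\ v = x.

(* Main.v *)
Require Import Defs.
From mathcomp Require Import all_boot all_order all_algebra.
From mathcomp Require Import classical_sets reals boolp ring lra.
Set Implicit Arguments.
Unset Strict Implicit.
Unset Printing Implicit Defensive.
Import Order.TTheory GRing.Theory Num.Theory.
Local Open Scope ring_scope.

(** Points of the alternative spectrahedron are certificates of infeasibility,
    and an irreducible infeasible subsystem leaves no freedom in their block
    support.

    Let [I] index an irreducible infeasible subsystem. A theorem of the
    alternative ([alt_spectrahedron_exists]) gives a point [X] of the alternative
    spectrahedron with block support contained in [I]. It does not need the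
    closedness of any cone: some shift of the pencil by [eps] times the identity
    remains infeasible, and the identity is an order unit, so the M. Riesz
    extension theorem ([conic_alternative]) yields a functional that is
    nonnegative on the cone, vanishes on the [A i] and is negative at [A0].
    Extending it to all square matrices, symmetric or not, and working with the
    cone of the matrices whose diagonal blocks indexed by [I] are positive, makes
    the representing matrix automatically symmetric, block-diagonal and zero
    outside these blocks.

    Next, some extreme point [Y] has its range contained in that of [X]
    ([exists_extreme_submx]). If a point is not extreme, it is interior to a
    segment, whose direction [D] is supported on the range of the point; moving
    along [D] to the boundary of the psd cone lowers the rank
    ([psd_rank_drop]), and the rank cannot decrease forever. Inclusion of ranges
    gives that the block support of [Y] is contained in [I].

    Finally, any point of the alternative spectrahedron certifies that the
    subsystem on its own block support is weakly infeasible
    ([alt_spectrahedron_infeasible]), because the trace inner product of two psd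
    matrices is nonnegative. By irreducibility the block support of [Y] is not a
    proper subset of [I], hence it is [I]. *)

(** * Quadratic forms and positive semidefinite matrices *)

(** The bilinear form of a square matrix; [bform M x x] is its quadratic
    form. *)
Definition bform (R : realType) (n : nat) (M : 'M[R]_n) (x z : 'cV[R]_n) : R :=
  (x^T *m M *m z) 0 0.

Lemma bformDr (R : realType) (n : nat) (M : 'M[R]_n) (x y z : 'cV[R]_n) :
  bform M x (y + z) = bform M x y + bform M x z.
Proof. by rewrite /bform mulmxDr mxE. Qed.

Lemma bformZr (R : realType) (n : nat) (M : 'M[R]_n) (c : R)
    (x z : 'cV[R]_n) : bform M x (c *: z) = c * bform M x z.
Proof. by rewrite /bform -scalemxAr mxE. Qed.

Lemma bformDl (R : realType) (n : nat) (M : 'M[R]_n) (x y z : 'cV[R]_n) :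
  bform M (x + y) z = bform M x z + bform M y z.
Proof. by rewrite /bform raddfD /= !mulmxDl mxE. Qed.

Lemma bformZl (R : realType) (n : nat) (M : 'M[R]_n) (c : R)
    (x z : 'cV[R]_n) : bform M (c *: x) z = c * bform M x z.
Proof. by rewrite /bform linearZ /= -!scalemxAl mxE. Qed.

Lemma bformMD (R : realType) (n : nat) (M N : 'M[R]_n) (x z : 'cV[R]_n) :
  bform (M + N) x z = bform M x z + bform N x z.
Proof. by rewrite /bform mulmxDr mulmxDl mxE. Qed.

Lemma bformMZ (R : realType) (n : nat) (M : 'M[R]_n) (c : R)
    (x z : 'cV[R]_n) : bform (c *: M) x z = c * bform M x z.
Proof. by rewrite /bform -scalemxAr -scalemxAl mxE. Qed.

Lemma bformE (R : realType) (n : nat) (M : 'M[R]_n) (x z : 'cV[R]_n) :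
  bform M x z = \sum_s \sum_t x s 0 * M s t * z t 0.
Proof.
rewrite /bform mxE exchange_big /=; apply: eq_bigr => t _.
by rewrite mxE big_distrl /=; apply: eq_bigr => s _; rewrite mxE.
Qed.

Lemma bform_delta (R : realType) (n : nat) (M : 'M[R]_n) (s t : 'I_n) :
  bform M (delta_mx s 0) (delta_mx t 0) = M s t.
Proof. by rewrite /bform trmx_delta -rowE -colE !mxE. Qed.

Lemma bform_deltal (R : realType) (n : nat) (M : 'M[R]_n) (s : 'I_n)
    (z : 'cV[R]_n) : bform M (delta_mx s 0) z = (M *m z) s 0.
Proof. by rewrite /bform trmx_delta -mulmxA -rowE mxE. Qed.

Lemma symmetricmxP (R : realType) (n : nat) (M : 'M[R]_n) :
  reflect (M^T = M) (M \is symmetricmx).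
Proof.
apply: (iffP (is_hermitianmxP _ _ _)); rewrite expr0 scale1r map_mx_id //.
Qed.

Lemma bform_sym (R : realType) (n : nat) (M : 'M[R]_n) (x z : 'cV[R]_n) :
  M^T = M -> bform M x z = bform M z x.
Proof.
move=> Ms; have trE (a : 'M[R]_1) : a 0 0 = a^T 0 0 by rewrite mxE.
by rewrite /bform trE !trmx_mul trmxK Ms mulmxA.
Qed.

Lemma psdP (R : realType) (n : nat) (M : 'M[R]_n) :
  psd M <-> M^T = M /\ forall x, 0 <= bform M x x.
Proof. by split=> [] [/symmetricmxP]. Qed.

Lemma bform_line (R : realType) (n : nat) (M : 'M[R]_n) (x z : 'cV[R]_n)
    (c : R) : M^T = M ->
  bform M (x + c *: z) (x + c *: z) =
    bform M x x + 2 * c * bform M x z + c ^+ 2 * bform M z z.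
Proof.
move=> Ms; rewrite !(bformDl, bformDr, bformZl, bformZr) (bform_sym z x Ms).
by ring.
Qed.

Lemma psd_cauchy_schwarz (R : realType) (n : nat) (M : 'M[R]_n)
    (x z : 'cV[R]_n) : psd M ->
  bform M x z ^+ 2 <= bform M x x * bform M z z.
Proof.
move=> /psdP [Ms Mp].
have Hz := Mp z.
have {Ms Mp} L c : 0 <= bform M x x + 2 * c * bform M x z + c ^+ 2 * bform M z z.
  by rewrite -bform_line.
move: (bform M x x) (bform M x z) (bform M z z) L Hz => a b d L.
rewrite le_eqVlt => /orP [/eqP d0 | d0].
  have [->|b0] := eqVneq b 0; first by rewrite -d0 expr0n mulr0.
  (* with d = 0 the bound L is affine in c; this value of c makes it -1 *)
  have := L (- (a + 1) / (2 * b)); rewrite -d0.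
  have -> : 2 * (- (a + 1) / (2 * b)) * b = - (a + 1) by field.
  by move=> H; exfalso; lra.
have := L (- b / d).
have -> : a + 2 * (- b / d) * b + (- b / d) ^+ 2 * d = (a * d - b ^+ 2) / d.
  by field; rewrite gt_eqF.
by rewrite pmulr_lge0 ?invr_gt0 // subr_ge0.
Qed.

Lemma psd_isotropic_ker (R : realType) (n : nat) (M : 'M[R]_n)
    (x : 'cV[R]_n) : psd M -> bform M x x = 0 -> M *m x = 0.
Proof.
move=> Mp Mx; apply/matrixP => s j; rewrite ord1 -bform_deltal mxE.
have := psd_cauchy_schwarz (delta_mx s 0) x Mp.
by rewrite Mx mulr0 => H; apply/eqP; rewrite -sqrf_eq0 eq_le H sqr_ge0.
Qed.

Lemma bform1E (R : realType) (n : nat) (x : 'cV[R]_n) :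
  bform 1%:M x x = \sum_s x s 0 ^+ 2.
Proof.
rewrite /bform mulmx1 mxE; apply: eq_bigr => s _; by rewrite mxE expr2.
Qed.

Lemma bform1_ge0 (R : realType) (n : nat) (x : 'cV[R]_n) :
  0 <= bform 1%:M x x.
Proof. by rewrite bform1E sumr_ge0 // => s _; rewrite sqr_ge0. Qed.

Lemma bform_le_norm (R : realType) (n : nat) (M : 'M[R]_n) :
  exists2 C : R, 0 <= C & forall x, `|bform M x x| <= C * bform 1%:M x x.
Proof.
exists (\sum_s \sum_t `|M s t|).
  by apply: sumr_ge0 => s _; apply: sumr_ge0.
move=> x; rewrite bformE mulr_suml.
apply: le_trans (ler_norm_sum _ _ _) _; apply: ler_sum => s _.
rewrite mulr_suml; apply: le_trans (ler_norm_sum _ _ _) _.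
apply: ler_sum => t _; rewrite !normrM mulrAC mulrC ler_wpM2l //.
have le1 u : `|x u 0| ^+ 2 <= bform 1%:M x x.
  rewrite bform1E (bigD1 u) //= real_normK ?num_real // lerDl.
  by rewrite sumr_ge0 // => v _; rewrite sqr_ge0.
have := le1 s; have := le1 t; have := sqr_ge0 (`|x s 0| - `|x t 0|).
by move: (`|x s 0|) (`|x t 0|) (bform _ _ _) => a b c; nra.
Qed.

(** The [s]-th coordinate of [Y x] is the form of [Y] at the [s]-th basis vector
    and [x], so Cauchy-Schwarz bounds its square by [Y s s * bform Y x x]. *)
Lemma psd_norm_mulmx_le (R : realType) (n : nat) (Y : 'M[R]_n)
    (x : 'cV[R]_n) : psd Y ->
  bform 1%:M (Y *m x) (Y *m x) <= \tr Y * bform Y x x.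
Proof.
move=> Yp; rewrite bform1E /mxtrace mulr_suml; apply: ler_sum => s _.
by rewrite -bform_deltal -[Y s s]bform_delta psd_cauchy_schwarz.
Qed.

Lemma psd_trace_ge0 (R : realType) (n : nat) (Y : 'M[R]_n) :
  psd Y -> 0 <= \tr Y.
Proof.
by move=> /psdP [_ Yp]; apply: sumr_ge0 => s _; rewrite -bform_delta.
Qed.

(** Moving slightly from a psd matrix [Y] in a direction supported on the
    range of [Y] preserves positivity: such a direction has the form
    [Y N Y], so its quadratic form is dominated by that of [Y]. *)
Lemma psd_perturb (R : realType) (n : nat) (Y D : 'M[R]_n) :
  psd Y -> D^T = D -> (D <= Y)%MS ->
  exists2 d : R, 0 < d & psd (Y + d *: D).
Proof.
move=> Yp Ds DY; have /psdP [Ys Yge] := Yp.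
pose G := pinvmx Y; pose N := G^T *m D *m G.
have DE : D = Y *m N *m Y.
  have DG : D *m G *m Y = D by apply: mulmxKpV.
  have YG : Y *m G^T *m D = D by have := congr1 trmx DG; rewrite !trmx_mul Ds Ys mulmxA.
  by rewrite /N -[LHS]YG -{1}DG !mulmxA.
have [C C0 CN] := bform_le_norm N.
have qD x : bform D x x = bform N (Y *m x) (Y *m x).
  by rewrite /bform DE trmx_mul Ys !mulmxA.
have tY := psd_trace_ge0 Yp.
(* K bounds the form of D by that of Y; the term 1 makes it positive *)
pose K := C * \tr Y + 1.
have K0 : 0 < K by rewrite /K; have := mulr_ge0 C0 tY; lra.
exists K^-1; first by rewrite invr_gt0.
apply/psdP; split; first by rewrite raddfD /= linearZ /= Ys Ds.
move=> x; rewrite bformMD bformMZ qD.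
have Dle : `|bform N (Y *m x) (Y *m x)| <= K * bform Y x x.
  apply: le_trans (CN _) _.
  apply: le_trans (ler_wpM2l C0 (psd_norm_mulmx_le x Yp)) _.
  by rewrite mulrA ler_wpM2r // /K lerDl.
have : - (K * bform Y x x) <= bform N (Y *m x) (Y *m x).
  by move: Dle; rewrite ler_norml => /andP [].
rewrite -(pmulr_rge0 _ K0) mulrDr mulrA mulfV ?gt_eqF // mul1r.
by rewrite -subr_ge0 opprK addrC.
Qed.

(** * Extreme points of the alternative spectrahedron *)

Lemma sym_bform_neq0 (R : realType) (n : nat) (D : 'M[R]_n) :
  D^T = D -> D != 0 -> exists x, bform D x x != 0.
Proof.
move=> Ds D0; apply: contrapT => /forallNP H; case/negP: D0; apply/eqP.
have {}H x : bform D x x = 0 by apply/eqP/negPn/negP/H.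
apply/matrixP => s t; rewrite mxE -bform_delta.
have := H (delta_mx s 0 + 1 *: delta_mx t 0).
by rewrite bform_line // !H; lra.
Qed.

(** A nonzero direction supported on the range of [X] leads to a psd matrix of
    smaller rank, on the boundary of the psd cone. *)
Lemma psd_rank_drop (R : realType) (n : nat) (X D : 'M[R]_n) :
  psd X -> D^T = D -> (D <= X)%MS -> D != 0 ->
  exists s : R, [/\ psd (X + s *: D), ((X + s *: D)%R <= X)%MS
                  & (\rank (X + s *: D)%R < \rank X)%N].
Proof.
move=> Xp Ds DX D0.
have [x qx] := sym_bform_neq0 Ds D0.
(* up to the sign of D, the half-line from X in the direction D leaves the psd
   cone *)
wlog qx_lt0 : D Ds DX D0 qx / bform D x x < 0.
  move=> W; have [qx0|qx0] := ltP (bform D x x) 0; first exact: W.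
  have qN : bform (- D) x x = - bform D x x by rewrite -scaleN1r bformMZ mulN1r.
  have [s Hs] : exists s : R, [/\ psd (X + s *: - D), ((X + s *: - D)%R <= X)%MS
      & (\rank (X + s *: - D)%R < \rank X)%N].
    apply: W; rewrite ?raddfN /= ?Ds ?oppr_eq0 ?qN ?oppr_eq0 //.
      by rewrite -scaleN1r scalemx_sub.
    by rewrite oppr_lt0 lt_def qx.
  by exists (- s); rewrite scaleNr -scalerN.
have {qx} Xx := (psdP X).1 Xp.
pose E : set R := [set s | psd (X + s *: D)]%classic.
have E0 : E 0 by rewrite /E /= scale0r addr0.
have Eub : has_ubound E.
  exists (bform X x x / - bform D x x) => s /psdP [_ /(_ x)].
  rewrite bformMD bformMZ ler_pdivlMr ?oppr_gt0 //.
  by move: (bform X x x) (bform D x x) => a b; lra.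
pose s := sup E.
have s0 : 0 <= s by apply: ub_le_sup.
have Yp : psd (X + s *: D).
  apply/psdP; split; first by rewrite raddfD /= linearZ /= Xx.1 Ds.
  move=> z; rewrite bformMD bformMZ.
  have [dz0|dz0] := leP 0 (bform D z z).
    by apply: addr_ge0; [exact: Xx.2|exact: mulr_ge0].
  have : s <= bform X z z / - bform D z z.
    apply: ge_sup; first by exists 0.
    move=> r /psdP [_ /(_ z)].
    rewrite bformMD bformMZ ler_pdivlMr ?oppr_gt0 //.
    by move: (bform X z z) (bform D z z) => a b; lra.
  rewrite ler_pdivlMr ?oppr_gt0 //.
  by move: (bform X z z) (bform D z z) => a b; lra.
have YX : ((X + s *: D)%R <= X)%MS by rewrite addmx_sub ?scalemx_sub.
(* at equal rank D would be supported on the range of X + s D, and one could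
   move beyond the supremum s *)
exists s; split => //; rewrite ltn_neqAle mxrankS // andbT.
apply/negP; rewrite (mxrank_leqif_sup YX) => XY.
have [d d0] := psd_perturb Yp Ds (submx_trans DX XY).
rewrite -addrA -scalerDl => Ed.
have : s + d <= s by apply: ub_le_sup.
by rewrite gerDl leNgt d0.
Qed.

Lemma psd_convex_submx (R : realType) (n : nat) (u v : 'M[R]_n) (t : R) :
  psd u -> psd v -> 0 < t < 1 -> (u <= (t *: u + (1 - t) *: v)%R)%MS.
Proof.
move=> up vp /andP [t0 t1]; set X := _ + _.
rewrite submxE; apply/eqP/matrixP => s j; rewrite [RHS]mxE.
have Xc : X *m col j (cokermx X) = 0 by rewrite colE mulmxA mulmx_coker mul0mx.
have := (psdP u).1 up; have := (psdP v).1 vp => -[vs vge] [us uge].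
have : bform X (col j (cokermx X)) (col j (cokermx X)) = 0.
  by rewrite /bform -mulmxA Xc mulmx0 mxE.
rewrite bformMD !bformMZ => H.
have u0 : bform u (col j (cokermx X)) (col j (cokermx X)) = 0.
  move: H (uge (col j (cokermx X))) (vge (col j (cokermx X))).
  move: (bform u _ _) (bform v _ _) => {uge vge us vs up vp Xc} a b; nra.
have /matrixP/(_ s 0) := psd_isotropic_ker up u0.
by rewrite colE mulmxA -colE !mxE.
Qed.

Lemma mxdotDr (R : realType) (n : nat) (M X Y : 'M[R]_n) :
  mxdot M (X + Y) = mxdot M X + mxdot M Y.
Proof. by rewrite /mxdot mulmxDr raddfD. Qed.

Lemma mxdotZr (R : realType) (n : nat) (M X : 'M[R]_n) (c : R) :
  mxdot M (c *: X) = c * mxdot M X.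
Proof. by rewrite /mxdot -scalemxAr linearZ. Qed.

Lemma mxdotE (R : realType) (n : nat) (M X : 'M[R]_n) :
  mxdot M X = \sum_s \sum_t M s t * X s t.
Proof.
rewrite /mxdot /mxtrace exchange_big /=; apply: eq_bigr => t _.
by rewrite mxE; apply: eq_bigr => s _; rewrite mxE.
Qed.

(** Points of minimal rank are extreme: below any point of the alternative
    spectrahedron, for the inclusion of ranges, there is an extreme point. *)
Lemma exists_extreme_submx (R : realType) (n m k : nat)
    (B : 'I_k -> {set 'I_n}) (A0 : 'M[R]_n) (A : 'I_m -> 'M[R]_n)
    (X : 'M[R]_n) :
  alt_spectrahedron B A0 A X ->
  exists2 Y, extreme_point (alt_spectrahedron B A0 A) Y & (Y <= X)%MS.
Proof.
have [r] := ubnP (\rank X); elim: r X => // r IH X; rewrite ltnS => Xr SX.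
have [eX|] := pselect (extreme_point (alt_spectrahedron B A0 A) X).
  by exists X.
move=> /not_andP [//|/existsNP [u /existsNP [v /existsNP [t]]]].
move=> /not_implyP [Su] /not_implyP [Sv] /not_implyP [t01] /not_implyP [XE uvX].
have [SX1 SX2 SX3 SX4] := SX.
have [Su1 Su2 Su3 Su4] := Su; have [Sv1 Sv2 Sv3 Sv4] := Sv.
pose D := u - v.
have D0 : D != 0.
  rewrite subr_eq0; apply: contra_notN uvX => /eqP uv.
  by move: XE; rewrite -uv -scalerDl addrC subrK scale1r.
have Ds : D^T = D.
  by rewrite raddfB /= ((psdP u).1 Su2).1 ((psdP v).1 Sv2).1.
have DX : (D <= X)%MS.
  have uX : (u <= X)%MS by rewrite XE psd_convex_submx.
  have vX : (v <= X)%MS.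
    have -> : X = (1 - t) *: v + (1 - (1 - t)) *: u by rewrite subKr addrC.
    apply: psd_convex_submx => //.
    by move: t01 => /andP [? ?]; apply/andP; split; lra.
  by rewrite addmx_sub ?eqmx_opp.
have mxdotD M : mxdot M u = mxdot M v -> mxdot M D = 0.
  by rewrite /D -scaleN1r mxdotDr mxdotZr => ->; rewrite mulN1r subrr.
have [s [Yp YX Yr]] := psd_rank_drop SX2 Ds DX D0.
have [||Z eZ ZY] := IH (X + s *: D); first exact: leq_trans Yr Xr.
  split => //.
  - by move=> a b ab; rewrite !mxE SX1 // Su1 // Sv1 // subrr mulr0 addr0.
  - by move=> i; rewrite mxdotDr mxdotZr SX3 mxdotD ?mulr0 ?addr0 ?Su3 ?Sv3.
  - by rewrite mxdotDr mxdotZr SX4 mxdotD ?mulr0 ?addr0 ?Su4 ?Sv4.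
by exists Z => //; apply: submx_trans ZY YX.
Qed.

(** * Extension of positive functionals *)

(** The graph of a linear functional defined on a subspace of [V]. That [F] is
    single-valued is not required; it follows from positivity on a cone
    containing 0. *)
Definition linear_graph (R : realType) (V : lmodType R) (F : V -> R -> Prop) :
    Prop :=
  F 0 0 /\ forall (c : R) w r w' r', F w r -> F w' r' ->
    F (c *: w + w') (c * r + r').

(** Closed under sums and nonnegative multiples. *)
Definition convex_cone (R : realType) (V : lmodType R) (K : V -> Prop) :
    Prop :=
  (forall v w, K v -> K w -> K (v + w)) /\
  (forall (c : R) v, 0 <= c -> K v -> K (c *: v)).

(** Positivity, on [K], of the functional with graph [F]. *)
Definition positive_on (R : realType) (V : lmodType R) (K : V -> Prop)
    (F : V -> R -> Prop) : Prop :=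
  forall w r, F w r -> K w -> 0 <= r.

Lemma linear_graphZ (R : realType) (V : lmodType R) (F : V -> R -> Prop)
    (c : R) w r : linear_graph F -> F w r -> F (c *: w) (c * r).
Proof.
by move=> [F0 FL] Fw; rewrite -[c *: w]addr0 -[c * r]addr0; apply: FL.
Qed.

Lemma linear_graphB (R : realType) (V : lmodType R) (F : V -> R -> Prop)
    w r w' r' : linear_graph F -> F w r -> F w' r' -> F (w - w') (r - r').
Proof.
move=> [F0 FL] Fw Fw'.
by rewrite addrC -(scaleN1r w') [r - r']addrC -(mulN1r r'); apply: FL.
Qed.

Lemma linear_graph_sum (R : realType) (V : lmodType R) (F : V -> R -> Prop)
    (I : finType) (c : I -> R) (w : I -> V) (r : I -> R) :
  linear_graph F -> (forall i, F (w i) (r i)) ->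
  F (\sum_i c i *: w i) (\sum_i c i * r i).
Proof.
move=> [F0 FL] Fw; apply: (big_rec2 F) => // i x y _ Fxy; exact: FL.
Qed.

(** One step of the M. Riesz extension theorem: the value [a] at the new vector
    [v] is the least one that positivity permits. *)
Lemma riesz_step (R : realType) (V : lmodType R) (K : V -> Prop)
    (F : V -> R -> Prop) (v : V) :
  convex_cone K -> linear_graph F -> positive_on K F ->
  (exists w r, F w r /\ K (v - w)) -> (exists w r, F w r /\ K (w - v)) ->
  exists F' (a : R),
    [/\ linear_graph F', positive_on K F', forall w r, F w r -> F' w r, F' v a
      & forall b, (forall w r, F w r -> K (v - w) -> r <= b) -> a <= b].
Proof.
move=> [KD KZ] FL Fp [w1 [r1 [Fw1 Kw1]]] [w2 [r2 [Fw2 Kw2]]].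
pose E : set R := [set r | exists2 w, F w r & K (v - w)]%classic.
have E1 : E r1 by exists w1.
have Ele w r : F w r -> K (w - v) -> ubound E r.
  move=> Fw Kw r' [w' Fw' Kw']; rewrite -subr_ge0.
  apply: Fp (linear_graphB FL Fw Fw') _.
  by rewrite -[w](subrK v) -addrA; apply: KD.
have Eub : has_ubound E by exists r2; apply: Ele Kw2.
have [F0 FD] := FL.
exists (fun w r => exists c w0 r0,
  [/\ F w0 r0, w = c *: v + w0 & r = c * sup E + r0]), (sup E).
split.
- split; first by exists 0, 0, 0; rewrite scale0r mul0r !addr0.
  move=> c w r w' r' [d [w0 [r0 [Fw0 -> ->]]]] [d' [w0' [r0' [Fw0' -> ->]]]].
  exists (c * d + d'), (c *: w0 + w0'), (c * r0 + r0'); split.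
  + exact: FD.
  + by rewrite scalerDr scalerA scalerDl addrACA.
  + by ring.
- move=> w r [c [w0 [r0 [Fw0 -> ->]]]] Kw.
  have [c0|c0|c0] := ltgtP c 0.
  + have nc0 : 0 < - c by rewrite oppr_gt0.
    have : sup E <= (- c)^-1 * r0.
      apply: ge_sup; first by exists r1.
      apply: Ele; first exact: (linear_graphZ (- c)^-1 FL Fw0).
      have : K ((- c)^-1 *: (c *: v + w0)) by apply: KZ; rewrite ?invr_ge0 ?ltW.
      rewrite scalerDr scalerA addrC.
      have -> : (- c)^-1 * c = -1 by field; rewrite lt_eqF.
      by rewrite scaleN1r.
    by rewrite mulrC ler_pdivlMr // => H; lra.
  + have : - (c^-1 * r0) <= sup E.
      apply: ub_le_sup => //; exists (- c^-1 *: w0).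
        by rewrite -mulNr; apply: linear_graphZ.
      rewrite scaleNr opprK.
      have : K (c^-1 *: (c *: v + w0)) by apply: KZ; rewrite ?invr_ge0 ?ltW.
      by rewrite scalerDr scalerA mulVf ?scale1r // gt_eqF.
    by rewrite lerNl mulrC ler_pdivlMr // => H; lra.
  + by move: Kw; rewrite c0 scale0r mul0r !add0r; apply: Fp.
- by move=> w r Fw; exists 0, w, r; rewrite scale0r mul0r !add0r.
- by exists 1, 0, 0; rewrite scale1r mul1r !addr0.
- move=> b Hb; apply: ge_sup; first by exists r1.
  by move=> r [w Fw Kw]; apply: Hb Kw.
Qed.

(** The M. Riesz extension theorem for a cone with an order unit [e], for the
    extension to finitely many vectors. *)
Lemma riesz_extension (R : realType) (V : lmodType R) (K : V -> Prop) (e : V)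
    (F : V -> R -> Prop) (vs : seq V) :
  convex_cone K -> (forall v, exists c : R, K (c *: e - v)) ->
  linear_graph F -> positive_on K F -> F e 1 ->
  exists F', [/\ linear_graph F', positive_on K F',
    forall w r, F w r -> F' w r & {in vs, forall v, exists a, F' v a}].
Proof.
move=> Kc Ke; elim: vs F => [|v vs IH] F FL Fp Fe.
  by exists F.
have [||F1 [a [F1L F1p F1F F1v _]]] := riesz_step (v := v) Kc FL Fp.
- have [c Kv] := Ke (- v); exists (- c *: e), (- c * 1); split.
    exact: linear_graphZ.
  by rewrite scaleNr opprK addrC; move: Kv; rewrite opprK.
- have [c Kv] := Ke v; exists (c *: e), (c * 1); split => //.
  exact: linear_graphZ.
have [F2 [F2L F2p F2F F2v]] := IH F1 F1L F1p (F1F _ _ Fe).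
exists F2; split => // [w r /F1F /F2F //|w].
rewrite inE => /predU1P [->|]; last exact: F2v.
by exists a; apply: F2F.
Qed.

(** The theorem of the alternative for the conic system
    [A0 - \sum_i y_i A_i \in K]: if it stays unsolvable after some positive
    shift along the order unit, then a positive functional vanishes on the
    [A_i] and is negative on [A0]. *)
Lemma conic_alternative (R : realType) (V : lmodType R) (K : V -> Prop)
    (e : V) (m : nat) (A0 : V) (A : 'I_m -> V) (eps : R) (vs : seq V) :
  convex_cone K -> K e -> (forall v, exists c : R, K (c *: e - v)) ->
  0 < eps ->
  (forall y : 'rV[R]_m, ~ K (A0 - \sum_i y 0 i *: A i + eps *: e)) ->
  exists F, [/\ linear_graph F, positive_on K F, forall i, F (A i) 0,
    exists2 a, F A0 a & a < 0 & {in vs, forall v, exists a, F v a}].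
Proof.
move=> Kc Ke Ku eps0 infeas; have [KD KZ] := Kc.
pose L (y : 'rV[R]_m) := \sum_i y 0 i *: A i.
have LD c y y' : L (c *: y + y') = c *: L y + L y'.
  rewrite /L scaler_sumr -big_split /=; apply: eq_bigr => i _.
  by rewrite !mxE scalerDl scalerA.
have LZ c y : L (c *: y) = c *: L y.
  rewrite /L scaler_sumr; apply: eq_bigr => i _.
  by rewrite !mxE scalerA.
have L0 : L 0 = 0 by rewrite /L big1 // => i _; rewrite mxE scale0r.
pose F w r := exists y, w = r *: e + L y.
have FL : linear_graph F.
  split; first by exists 0; rewrite L0 scale0r addr0.
  move=> c w r w' r' [y ->] [y' ->]; exists (c *: y + y').
  by rewrite LD scalerDr scalerA scalerDl addrACA.
have Fp : positive_on K F.
  move=> w r [y ->] Kw; rewrite leNgt; apply/negP => r0.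
  have nr0 : 0 < - r by rewrite oppr_gt0.
  have [c] := Ku (- A0); rewrite opprK => Kc0.
  have [c0|c0] := leP 0 c; last first.
    (* A0 - |c| e lies in K, hence so does A0 *)
    apply: (infeas 0); rewrite -/(L 0) L0 subr0.
    have -> : A0 + eps *: e = (c *: e + A0) + (eps - c) *: e.
      by rewrite [RHS]addrAC -scalerDl [c + _]addrC subrK addrC.
    by apply: KD => //; apply: KZ => //; lra.
  apply: (infeas ((c / r) *: y)); rewrite -/(L _) LZ.
  have -> : A0 - (c / r) *: L y + eps *: e =
      (c *: e + A0) + (c / - r) *: (r *: e + L y) + eps *: e.
    rewrite scalerDr scalerA.
    have -> : c / - r * r = - c by field; rewrite lt_eqF.
    have -> : c / - r = - (c / r) by field; rewrite lt_eqF.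
    rewrite !scaleNr; congr (_ + _).
    by rewrite addrACA subrr add0r.
  apply: (KD); last by apply: KZ => //; apply: ltW.
  by apply: KD => //; apply: KZ => //; apply: divr_ge0 => //; apply: ltW.
have Fe : F e 1 by exists 0; rewrite L0 scale1r addr0.
have FA i : F (A i) 0.
  exists (delta_mx 0 i); rewrite scale0r add0r /L (bigD1 i) //= !mxE !eqxx.
  rewrite scale1r big1 ?addr0 // => j ji.
  by rewrite !mxE (negPf ji) andbF scale0r.
have [||F1 [a [F1L F1p F1F F1v F1min]]] := riesz_step (v := A0) Kc FL Fp.
- have [c Kv] := Ku (- A0); exists (- c *: e), (- c * 1); split.
    exact: linear_graphZ.
  by rewrite scaleNr opprK addrC; move: Kv; rewrite opprK.
- have [c Kv] := Ku A0; exists (c *: e), (c * 1); split => //.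
  exact: linear_graphZ.
have a0 : a < 0.
  apply: (@le_lt_trans _ _ (- eps)); last by rewrite oppr_lt0.
  apply: F1min => w r [y ->] Kw; rewrite leNgt; apply/negP => re.
  apply: (infeas y); rewrite -/(L y).
  have -> : A0 - L y + eps *: e = A0 - (r *: e + L y) + (eps + r) *: e.
    by rewrite scalerDl [r *: e + _]addrC opprD [eps *: e + _]addrC !addrA subrK.
  by apply: KD => //; apply: KZ => //; lra.
have [F2 [F2L F2p F2F F2v]] := riesz_extension vs Kc Ku F1L F1p (F1F _ _ Fe).
exists F2; split => //; first by move=> i; apply/F2F/F1F.
by exists a => //; apply: F2F.
Qed.

(** * Principal submatrices and block decompositions *)

(** [x] vanishes outside [J]. *)
Definition supported (R : realType) (n : nat) (J : {set 'I_n})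
    (x : 'cV[R]_n) : Prop :=
  forall s, s \notin J -> x s 0 = 0.

Lemma bform_prin_submx (R : realType) (n : nat) (J : {set 'I_n})
    (M : 'M[R]_n) (x : 'cV[R]_n) : supported J x ->
  let y := \col_j x (enum_val j) 0 in
  bform (prin_submx J M) y y = bform M x x.
Proof.
move=> xJ /=; rewrite !bformE.
have restr (f : 'I_n -> R) : (forall s, s \notin J -> f s = 0) ->
    \sum_s f s = \sum_(j < #|J|) f (enum_val j).
  move=> f0; rewrite -big_enum_val /= big_mkcond [RHS]big_mkcond /=.
  by apply: eq_bigr => s _; case: ifPn => // /f0.
rewrite [RHS]restr; last first.
  by move=> s /xJ xs; apply: big1 => t _; rewrite xs !mul0r.
apply: eq_bigr => s _; rewrite [RHS]restr; last by move=> t /xJ ->; rewrite mulr0.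
by apply: eq_bigr => t _; rewrite !mxE.
Qed.

Lemma supported_extension (R : realType) (n : nat) (J : {set 'I_n})
    (y : 'cV[R]_#|J|) :
  exists2 x : 'cV[R]_n, supported J x & y = \col_j x (enum_val j) 0.
Proof.
exists (\col_s \sum_j (enum_val j == s)%:R * y j 0).
  move=> s sJ; rewrite mxE big1 // => j _.
  by case: eqP => [E|]; rewrite ?mul0r //; rewrite -E enum_valP in sJ.
apply/matrixP => j t; rewrite ord1 !mxE (bigD1 j) //= eqxx mul1r big1 ?addr0 //.
by move=> i ij; rewrite (inj_eq enum_val_inj) (negPf ij) mul0r.
Qed.

Lemma psd_prin_submx (R : realType) (n : nat) (J : {set 'I_n}) (M : 'M[R]_n) :
  M^T = M ->
  psd (prin_submx J M) <-> forall x, supported J x -> 0 <= bform M x x.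
Proof.
move=> Ms; rewrite psdP; split=> [[_ Mp] x xJ|Mp].
  by rewrite -(bform_prin_submx M xJ).
split; first by rewrite /prin_submx trmx_mxsub Ms.
move=> y; have [x xJ ->] := supported_extension y.
by rewrite bform_prin_submx //; apply: Mp.
Qed.

Lemma prin_submx_shift (R : realType) (n : nat) (J : {set 'I_n})
    (M : 'M[R]_n) (c : R) :
  prin_submx J M + c%:M = prin_submx J (M + c%:M).
Proof. by apply/matrixP => s t; rewrite !mxE (inj_eq enum_val_inj). Qed.

Lemma prin_submx_eq0P (R : realType) (n : nat) (J : {set 'I_n})
    (M : 'M[R]_n) :
  reflect ({in J &, forall s t, M s t = 0}) (prin_submx J M == 0).
Proof.
apply: (iffP eqP) => [/matrixP M0 s t sJ tJ|M0].
  have := M0 (enum_rank_in sJ s) (enum_rank_in tJ t).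
  by rewrite !mxE !enum_rankK_in.
by apply/matrixP => s t; rewrite !mxE M0 // enum_valP.
Qed.

Lemma block_partition_uniq (n k : nat) (B : 'I_k -> {set 'I_n}) (i j : 'I_k)
    (s : 'I_n) : block_partition B -> s \in B i -> s \in B j -> i = j.
Proof.
move=> [Binj /and3P [_ /finset.trivIsetP BT _]] si sj; apply: contrapT => /eqP ij.
have /BT : B i \in [set B i | i : 'I_k]%SET by apply: imset_f.
move=> /(_ (B j)); rewrite imset_f // (inj_eq Binj) => /(_ isT ij).
by move=> /disjointFr /(_ si); rewrite sj.
Qed.

Lemma block_partition_cover (n k : nat) (B : 'I_k -> {set 'I_n}) (s : 'I_n) :
  block_partition B -> exists i, s \in B i.
Proof.
move=> [_ /and3P [/eqP BC _ _]]; have : s \in [set: 'I_n]%SET by rewrite inE.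
by rewrite -BC => /bigcupP [_ /imsetP [i _ ->] si]; exists i.
Qed.

(** The matrices whose diagonal blocks indexed by [I] have nonnegative quadratic
    forms. No symmetry is required, so that the cone has an order unit in the
    space of all square matrices. *)
Definition block_cone (R : realType) (n k : nat) (B : 'I_k -> {set 'I_n})
    (I : {set 'I_k}) (M : 'M[R]_n) : Prop :=
  forall i, i \in I -> forall x, supported (B i) x -> 0 <= bform M x x.

Lemma convex_block_cone (R : realType) (n k : nat) (B : 'I_k -> {set 'I_n})
    (I : {set 'I_k}) : convex_cone (block_cone (R := R) B I).
Proof.
split=> [M N KM KN i iI x xi|c M c0 KM i iI x xi].
  by rewrite bformMD addr_ge0 // ?(KM i) ?(KN i).
by rewrite bformMZ mulr_ge0 // (KM i).
Qed.

Lemma block_cone_order_unit (R : realType) (n k : nat)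
    (B : 'I_k -> {set 'I_n}) (I : {set 'I_k}) (M : 'M[R]_n) :
  exists c : R, block_cone B I (c *: 1%:M - M).
Proof.
have [c _ Mc] := bform_le_norm M; exists c => i _ x _.
rewrite bformMD bformMZ -scaleN1r bformMZ mulN1r subr_ge0.
exact: le_trans (ler_norm _) (Mc x).
Qed.

(** A block-diagonal matrix is psd on a union of blocks as soon as its form is
    nonnegative on each of them: cross terms between blocks vanish. *)
Lemma psd_block_union (R : realType) (n k : nat) (B : 'I_k -> {set 'I_n})
    (I : {set 'I_k}) (M : 'M[R]_n) :
  block_partition B -> M^T = M -> block_diagonal B M -> block_cone B I M ->
  psd (prin_submx (block_union B I) M).
Proof.
move=> Bp Ms Mb KM; apply/psd_prin_submx => // x xI.
pose xb i : 'cV[R]_n := \col_s (if s \in B i then x s 0 else 0).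
have xbB i : supported (B i) (xb i) by move=> s /negPf si; rewrite mxE si.
have xE : x = \sum_(i in I) xb i.
  apply/matrixP => s j; rewrite ord1 summxE.
  have [i si] := block_partition_cover s Bp.
  have z j' : j' != i -> xb j' s 0 = 0.
    move=> ji; apply: xbB; apply: contra ji => sj.
    by apply/eqP; apply: block_partition_uniq Bp sj si.
  have [iI|iI] := boolP (i \in I).
    rewrite (bigD1 i) //= mxE si big1 ?addr0 // => j' /andP [_]; exact: z.
  rewrite big1 => [|j' j'I]; last by apply: z; apply: contraNneq iI => <-.
  apply: xI; apply/bigcupP => -[j' j'I sj']; case/negP: iI.
  by rewrite (block_partition_uniq Bp si sj').
have xb0 i j : i != j -> bform M (xb i) (xb j) = 0.
  move=> ij; rewrite bformE big1 // => s _; rewrite big1 // => t _.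
  rewrite !mxE; case: ifP => si; last by rewrite !mul0r.
  case: ifP => tj; last by rewrite mulr0.
  rewrite Mb ?mulr0 ?mul0r // => -[l [sl tl]]; case/eqP: ij.
  by rewrite (block_partition_uniq Bp si sl) (block_partition_uniq Bp tl tj).
have suml z : bform M x z = \sum_(i in I) bform M (xb i) z.
  rewrite {1}xE; apply: (big_morph (fun u => bform M u z)) => [u v|].
    exact: bformDl.
  by rewrite -(scale0r 0) bformZl mul0r.
have sumr z : bform M z x = \sum_(i in I) bform M z (xb i).
  rewrite {1}xE; apply: (big_morph (fun u => bform M z u)) => [u v|].
    exact: bformDr.
  by rewrite -(scale0r 0) bformZr mul0r.
rewrite suml sumr_ge0 // => i iI; rewrite sumr (bigD1 i) //= big1 ?addr0.
  exact: (KM i iI _ (xbB i)).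
by move=> j /andP [_ ji]; rewrite xb0 // eq_sym.
Qed.

Lemma block_diagonal_pencil (R : realType) (n m k : nat)
    (B : 'I_k -> {set 'I_n}) (A0 : 'M[R]_n) (A : 'I_m -> 'M[R]_n)
    (y : 'rV[R]_m) (c : R) :
  block_partition B -> block_diagonal B A0 ->
  (forall i, block_diagonal B (A i)) ->
  block_diagonal B (pencil A0 A y + c%:M).
Proof.
move=> Bp A0b Ab s t st; rewrite !mxE A0b // summxE big1 => [|i _].
  case: eqP => [E|]; last by rewrite subr0 addr0.
  by case: st; have [i si] := block_partition_cover s Bp; exists i; rewrite -E.
by rewrite mxE Ab ?mulr0.
Qed.

Lemma sym_pencil (R : realType) (n m : nat) (A0 : 'M[R]_n)
    (A : 'I_m -> 'M[R]_n) (y : 'rV[R]_m) (c : R) :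
  A0^T = A0 -> (forall i, (A i)^T = A i) ->
  (pencil A0 A y + c%:M)^T = pencil A0 A y + c%:M.
Proof.
move=> A0s As; rewrite /pencil raddfD raddfB /= tr_scalar_mx A0s raddf_sum /=.
by under eq_bigr do rewrite linearZ /= As.
Qed.

(** * Infeasibility certificates *)

Lemma mxdotC (R : realType) (n : nat) (M X : 'M[R]_n) : mxdot M X = mxdot X M.
Proof.
by rewrite !mxdotE; under eq_bigr do under eq_bigr do rewrite mulrC.
Qed.

Lemma mxdot_rank1 (R : realType) (n : nat) (M : 'M[R]_n) (x : 'cV[R]_n) :
  mxdot M (x *m x^T) = bform M x x.
Proof.
rewrite mxdotE bformE; apply: eq_bigr => s _; apply: eq_bigr => t _.
by rewrite mxE big_ord1 mxE mulrCA mulrA.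
Qed.

Lemma bform_rank1 (R : realType) (n : nat) (x z : 'cV[R]_n) :
  bform (x *m x^T) z z = (x^T *m z) 0 0 ^+ 2.
Proof.
rewrite /bform mulmxA -mulmxA [LHS]mxE big_ord1 expr2; congr (_ * _).
by rewrite -[z^T *m x]trmxK mxE trmx_mul trmxK.
Qed.

(** One half of the self-duality of the psd cone, relative to a support [J]. The
    proof is by induction on the number of nonzero diagonal entries of [X]: each
    Cholesky step removes a rank-one term of [X] and clears such an entry. *)
Lemma mxdot_psd_ge0 (R : realType) (n : nat) (J : {set 'I_n})
    (M X : 'M[R]_n) :
  psd X -> (forall s, s \notin J -> X s s = 0) ->
  (forall x, supported J x -> 0 <= bform M x x) -> 0 <= mxdot M X.
Proof.
move=> Xp XJ MJ.
have [r] := ubnP #|[set s | X s s != 0]%SET|.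
elim: r X Xp XJ => // r IH X Xp XJ; rewrite ltnS => Xr.
have /psdP [Xs Xge] := Xp.
have col0 s t : X s s = 0 -> X t s = 0.
  rewrite -bform_delta => /(psd_isotropic_ker Xp) /matrixP /(_ t 0).
  by rewrite -colE !mxE.
have [s Xss|Xd] := pickP (fun s => X s s != 0); last first.
  rewrite mxdotE big1 // => s _; rewrite big1 // => t _.
  by rewrite col0 ?mulr0 //; apply/eqP/negbFE/Xd.
have d0 : 0 < X s s by rewrite lt_def Xss -[X s s]bform_delta Xge.
pose v := X *m delta_mx s 0 : 'cV[R]_n.
have vE t : v t 0 = X t s by rewrite /v -colE mxE.
pose X' := X - (X s s)^-1 *: (v *m v^T).
have XE : X = X' + (X s s)^-1 *: (v *m v^T) by rewrite subrK.
have X'E t : X' t t = X t t - (X s s)^-1 * X t s ^+ 2.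
  have vv : (v *m v^T) t t = X t s ^+ 2.
    by rewrite mxE big_ord1 [v^T _ _]mxE vE expr2.
  by rewrite -vv /X' mxE; congr (_ + _); rewrite mxE; congr (- _); rewrite mxE.
have X'p : psd X'.
  apply/psdP; split.
    by rewrite raddfB /= linearZ /= trmx_mul trmxK Xs.
  move=> x; rewrite bformMD -scaleNr bformMZ bform_rank1 mulNr.
  have -> : (v^T *m x) 0 0 = bform X (delta_mx s 0) x.
    by rewrite /bform /v trmx_mul Xs.
  rewrite subr_ge0 mulrC ler_pdivrMr // mulrC -[X s s]bform_delta.
  exact: psd_cauchy_schwarz.
have X'0 t : X t t = 0 -> X' t t = 0.
  move=> Xt; rewrite X'E Xt.
  by have := col0 t s Xt; rewrite -{1}Xs mxE => ->; rewrite expr0n mulr0 subr0.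
rewrite XE mxdotDr mxdotZr mxdot_rank1; apply: addr_ge0.
  apply: IH => // [t tJ|]; first by apply/X'0/XJ.
  apply: leq_trans Xr; apply: proper_card; apply/properP; split.
    by apply/fintype.subsetP => t; rewrite !inE; apply: contra => /eqP /X'0 ->.
  exists s; rewrite inE // negbK X'E expr2 mulrA mulVf ?mul1r ?subrr //.
rewrite mulr_ge0 ?invr_ge0 ?(ltW d0) //; apply: MJ => t tJ.
by rewrite vE -Xs mxE col0 // XJ.
Qed.

(** A point of the alternative spectrahedron certifies that the subsystem on its
    block support is weakly infeasible. *)
Lemma alt_spectrahedron_infeasible (R : realType) (n m k : nat)
    (B : 'I_k -> {set 'I_n}) (A0 : 'M[R]_n) (A : 'I_m -> 'M[R]_n)
    (X : 'M[R]_n) :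
  block_partition B -> A0^T = A0 -> (forall i, (A i)^T = A i) ->
  alt_spectrahedron B A0 A X ->
  weakly_infeasible (block_subsystem B A0 A (block_support B X)).
Proof.
move=> Bp A0s As [Xb Xp XA XA0] feas.
have tX := psd_trace_ge0 Xp.
(* pairing X with the pencil shifted by eps gives -1 + eps * tr X, which is
   negative for this eps *)
have eps0 : 0 < (\tr X + 1)^-1 by rewrite invr_gt0 ltr_wpDl.
have [y] := feas _ eps0; rewrite prin_submx_shift => Py.
have := mxdot_psd_ge0 Xp _ ((psd_prin_submx _ (sym_pencil y _ A0s As)).1 Py).
have -> : mxdot (pencil A0 A y + (\tr X + 1)^-1%:M) X =
    -1 + (\tr X + 1)^-1 * \tr X.
  rewrite mxdotC mxdotDr -scalemx1 mxdotZr {2}/mxdot mulmx1 mxtrace_tr.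
  congr (_ + _); rewrite /pencil mxdotDr mxdotC XA0 -scaleN1r mxdotZr.
  rewrite (big_morph (mxdot X) (mxdotDr X) (_ : _ = 0)); last first.
    by rewrite -(scale0r 0) mxdotZr mul0r.
  rewrite big1 ?mulr0 ?addr0 // => i _.
  by rewrite mxdotZr mxdotC XA mulr0.
have -> : -1 + (\tr X + 1)^-1 * \tr X = - (\tr X + 1)^-1.
  by field; rewrite gt_eqF // ltr_wpDl.
rewrite oppr_ge0 leNgt eps0 => H; apply: notF; apply: H => s sJ.
have [i si] := block_partition_cover s Bp.
have /prin_submx_eq0P -> // : prin_submx (B i) X == 0.
apply: contraNT sJ => Xi; apply/bigcupP; exists i => //.
by rewrite inE.
Qed.

(** Conversely, a weakly infeasible block subsystem has a certificate: the
    functional of the conic alternative for [block_cone B I], represented by a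
    matrix, is psd and supported on the diagonal blocks indexed by [I]. *)
Lemma alt_spectrahedron_exists (R : realType) (n m k : nat)
    (B : 'I_k -> {set 'I_n}) (A0 : 'M[R]_n) (A : 'I_m -> 'M[R]_n)
    (I : {set 'I_k}) :
  block_partition B -> A0^T = A0 -> (forall i, (A i)^T = A i) ->
  block_diagonal B A0 -> (forall i, block_diagonal B (A i)) ->
  weakly_infeasible (block_subsystem B A0 A I) ->
  exists2 X, alt_spectrahedron B A0 A X & block_support B X \subset I.
Proof.
move=> Bp A0s As A0b Ab.
move=> /existsNP [eps /not_implyP [eps0 /forallNP infeas]].
pose K := block_cone (R := R) B I.
have Kinf (y : 'rV[R]_m) :
    ~ K (A0 - \sum_i y 0 i *: A i + eps *: 1%:M).
  rewrite scalemx1 => Ky; apply: (infeas y).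
  rewrite prin_submx_shift; apply: psd_block_union => //.
    exact: sym_pencil.
  exact: block_diagonal_pencil.
have K1 : K 1%:M by move=> i _ x _; apply: bform1_ge0.
pose vs : seq 'M[R]_n := [seq delta_mx p.1 p.2 | p : 'I_n * 'I_n].
have [F [FL Fp FA [a FA0 a0] Fvs]] := conic_alternative vs
  (convex_block_cone R B I) K1 (block_cone_order_unit B I) eps0 Kinf.
have /choice [z Fz] : forall p : 'I_n * 'I_n, exists r, F (delta_mx p.1 p.2) r.
  by move=> p; apply: Fvs; apply: map_f; rewrite mem_enum.
pose Z := \matrix_(s, t) z (s, t).
have FZ W : F W (mxdot W Z).
  rewrite mxdotE {1}[W]matrix_sum_delta !pair_bigA /=.
  apply: (linear_graph_sum (fun p => W p.1 p.2)) => // p.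
  by rewrite mxE; case: p (Fz p).
(* the functional vanishes on the lineality space of the cone *)
have Fnull W r : (forall i, i \in I -> forall x, supported (B i) x ->
    bform W x x = 0) -> F W r -> r = 0.
  move=> W0 FW; apply/eqP; rewrite eq_le; apply/andP; split.
    rewrite -oppr_ge0 -mulN1r; apply: (Fp _ _ (linear_graphZ (-1) FL FW)).
    by move=> i iI x xi; rewrite bformMZ (W0 i) ?mulr0.
  by apply: (Fp _ _ FW) => i iI x xi; rewrite (W0 i).
have Funiq W r : F W r -> mxdot W Z = r.
  move=> FW; apply/eqP; rewrite -subr_eq0; apply/eqP.
  apply: Fnull (linear_graphB FL (FZ W) FW) => i _ x _.
  by rewrite subrr /bform mulmx0 mul0mx mxE.
have Z0 W : (forall i, i \in I -> forall x, supported (B i) x ->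
    bform W x x = 0) -> mxdot W Z = 0.
  by move=> W0; apply: Fnull W0 (FZ W).
have mxdot_delta s t : mxdot (delta_mx s t) Z = Z s t.
  by rewrite (Funiq _ _ (Fz (s, t))) mxE.
have bform_deltamx (s t : 'I_n) (x : 'cV[R]_n) :
    bform (delta_mx s t) x x = x s 0 * x t 0.
  rewrite bformE (bigD1 s) //= (bigD1 t) //= !mxE !eqxx mulr1.
  rewrite big1 => [|t' /negPf tt']; last by rewrite mxE tt' andbF mulr0 mul0r.
  rewrite big1 ?addr0 // => s' /negPf ss'; rewrite big1 // => t' _.
  by rewrite mxE ss' mulr0 mul0r.
have Zb s t : (forall i, i \in I -> ~ (s \in B i /\ t \in B i)) -> Z s t = 0.
  move=> st; rewrite -mxdot_delta; apply: Z0 => i iI x xi.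
  rewrite bform_deltamx; have [si|/xi ->] := boolP (s \in B i); rewrite ?mul0r //.
  rewrite [x t 0]xi ?mulr0 //; apply/negP => ti; exact: (st i).
have Zs : Z^T = Z.
  apply/matrixP => s t; rewrite mxE; apply/eqP; rewrite -subr_eq0; apply/eqP.
  rewrite -!mxdot_delta ![mxdot _ Z]mxdotC -mulN1r -mxdotZr -mxdotDr mxdotC.
  apply: Z0 => i _ x _; rewrite bformMD bformMZ !bform_deltamx; ring.
have Zp : psd Z.
  apply/psdP; split=> // x; rewrite -mxdot_rank1 mxdotC.
  by apply: (Fp _ _ (FZ _)) => i _ w _; rewrite bform_rank1 sqr_ge0.
have c0 : 0 < (- a)^-1 by rewrite invr_gt0 oppr_gt0.
exists ((- a)^-1 *: Z).
  split.
  - move=> s t st; rewrite mxE Zb ?mulr0 // => i _ [si ti].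
    by apply: st; exists i.
  - apply/psdP; split; first by rewrite linearZ /= Zs.
    by move=> x; rewrite bformMZ mulr_ge0 ?(ltW c0) // ((psdP Z).1 Zp).2.
  - by move=> i; rewrite mxdotZr (Funiq _ _ (FA i)) mulr0.
  - by rewrite mxdotZr (Funiq _ _ FA0); field; rewrite lt_eqF.
apply/fintype.subsetP => i; rewrite inE; apply: contraNT => iI.
apply/prin_submx_eq0P => s t si ti; rewrite mxE Zb ?mulr0 // => j jI [sj _].
by move: iI; rewrite (block_partition_uniq Bp si sj) jI.
Qed.

Lemma block_support_submx (R : realType) (n k : nat) (B : 'I_k -> {set 'I_n})
    (X Y : 'M[R]_n) :
  psd X -> (Y <= X)%MS -> block_support B Y \subset block_support B X.
Proof.
move=> Xp /submxP [W ->]; apply/fintype.subsetP => i; rewrite !inE.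
apply: contra => /prin_submx_eq0P X0; apply/prin_submx_eq0P => s t si ti.
have : X *m delta_mx t 0 = 0 :> 'cV_n.
  by apply: psd_isotropic_ker; rewrite // bform_delta X0.
move=> Xt; have : (W *m X *m delta_mx t 0 : 'cV_n) s 0 = 0.
  by rewrite -mulmxA Xt mulmx0 mxE.
by rewrite -colE mxE.
Qed.

Theorem theorem3p5 (R : realType) (n m k : nat)
    (A0 : 'M[R]_n) (A : 'I_m -> 'M[R]_n) (B : 'I_k -> {set 'I_n})
    (A0_sym : A0 \is symmetricmx)
    (A_sym : forall i : 'I_m, A i \is symmetricmx)
    (k_ge1 : (1 <= k)%N)
    (B_part : block_partition B)
    (A0_block : block_diagonal B A0)
    (A_block : forall i : 'I_m, block_diagonal B (A i))
    (blocks_feasible : forall i : 'I_k,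
      weakly_feasible (fun y : 'rV[R]_m => prin_submx (B i) (pencil A0 A y)))
    (Sigma_infeasible : weakly_infeasible (pencil A0 A)) :
  forall I : {set 'I_k}, is_IIS B A0 A I ->
    exists X : 'M[R]_n,
      extreme_point (alt_spectrahedron B A0 A) X /\ block_support B X = I.
Proof.
move=> I [Iinf Imin].
have A0s := symmetricmxP _ A0_sym; have As i := symmetricmxP _ (A_sym i).
have [X SX XI] := alt_spectrahedron_exists B_part A0s As A0_block A_block Iinf.
have [Y eY YX] := exists_extreme_submx SX.
exists Y; split=> //; apply/eqP.
have YI : block_support B Y \subset I.
  by apply: fintype.subset_trans XI; apply: block_support_submx YX; case: SX.
apply/negPn/negP => YnI.
apply: (alt_spectrahedron_infeasible B_part A0s As eY.1).
by apply: Imin; rewrite finset.properEneq YnI.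
Qed.
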